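(* Every eigenfunction of $K$ (in particular each of the functions $\phi_1,\phi_2,\phi_3,\ldots$) is continuous on $[0,1]$.
   Context: Let $K:[0,1]\times[0,1]\to\mathbb R$ be defined by $K(x,y)=\frac12-\{(xy)^{-1}\}$ if $0<x,y\le 1$, and $K(x,y)=0$ if $0\le x,y\le1$ and $xy=0$, where $\{\alpha\}=\alpha-\lfloor\alpha\rfloor$. Let $L^2([0,1])$ denote the space of real-valued Lebesgue measurable square-integrable functions on $[0,1]$, with $\langle f,g\rangle=\int_0^1 f(x)g(x)\,dx$ and $\|f\|=\langle f,f\rangle^{1/2}$. A function $\phi$ is an eigenfunction of $K$ (with eigenvalue $\lambda\in\mathbb R$) if $\phi\in L^2([0,1])$, $\|\phi\|>0$, and $\phi(x)=\lambda\int_0^1 K(x,y)\phi(y)\,dy$ for every $x\in[0,1]$. Let $\phi_1,\phi_2,\ldots$ be a maximal orthonormal system in $L^2([0,1])$ of eigenfunctions of $K$, $\phi_j$ having the nonzero real eigenvalue $\lambda_j$, numbered so that $0<|\lambda_1|\le|\lambda_2|\le\cdots$ and $\lambda_j\ge\lambda_{j+1}$ whenever $|\lambda_j|=|\lambda_{j+1}|$. *)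

(* Defs.v *)
From HB Require Import structures.
From mathcomp Require Import all_boot all_order all_algebra.
From mathcomp Require Import all_classical all_reals all_analysis.
Set Implicit Arguments. Unset Strict Implicit. Unset Printing Implicit Defensive.
Import Order.TTheory GRing.Theory Num.Theory.
Import numFieldNormedType.Exports.
Local Open Scope classical_set_scope.
Local Open Scope ring_scope.

Definition fracpart {R : realType} (a : R) : R := a - (Num.floor a)%:~R.

(* The kernel K(x,y) = 1/2 - {(xy)^-1} for 0 < x,y <= 1, and 0 when xy = 0.
   Only its values on [0,1]x[0,1] matter below. *)
Definition Kker {R : realType} (x y : R) : R :=
  if (0 < x) && (0 < y) then 2^-1 - fracpart ((x * y)^-1) else 0.

(* R equipped with the Lebesgue (= completed, Caratheodory) sigma-algebra;
   its carrier is convertible to R. *)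
Definition LebR (R : realType) : measurableType _ :=
  caratheodory_type (@lebesgue_stieltjes_measure R idfun)^*%mu.

Notation leb := (@completed_lebesgue_measure _).

Definition I01 {R : realType} : set (LebR R) := `[0%R, 1%R].

Definition is_eigenfunction {R : realType} (phi : R -> R) (lam : R) : Prop :=
  [/\ measurable_fun (@I01 R) (phi : LebR R -> R),
      leb.-integrable (@I01 R) (fun x : LebR R => (phi x ^+ 2)%:E),
      (0 < \int[leb]_(x in @I01 R) (phi x ^+ 2)%:E)%E
    & forall x : R, x \in `[0%R, 1%R] ->
        phi x = lam * Rintegral leb (@I01 R)
                        (fun y : LebR R => Kker x y * phi y)].

(* Main.v *)
Require Import Defs.
From HB Require Import structures.
From mathcomp Require Import all_boot all_order all_algebra.
From mathcomp Require Import all_classical all_reals all_analysis.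
From mathcomp Require Import measurable_realfun ring lra.
Set Implicit Arguments.
Unset Strict Implicit.
Unset Printing Implicit Defensive.
Import Order.TTheory GRing.Theory Num.Theory.
Import numFieldNormedType.Exports.
Local Open Scope classical_set_scope.
Local Open Scope ring_scope.

(** Let [T x] be the integral of [K(x,y) phi(y)] over [0,1], so that
    [phi = lam T] on [0,1].  At [x > 0], [K(.,y)] is continuous except when
    [1/(xy)] is an integer, which happens for countably many [y] only, and
    dominated convergence gives the continuity of [T].  At [0], where [T]
    vanishes, one needs a Riemann-Lebesgue lemma: [K(x,.)] tends weakly to [0]
    as [x] tends to [0+].  For a bounded family this holds against every
    integrable function once it holds against the indicators of rays, so it is
    enough to bound the integral of [K(x,.)] over [0,t].  Between the
    consecutive jumps [1/(x(n+1))] and [1/(xn)] the kernel is within [1/n] of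
    an affine function with zero integral; adding up these pieces bounds the
    integral over [0,t] by [2 x t^2]. *)

Section caratheodory_extension.
Context d (T : semiRingOfSetsType d) {R : realType}.
Variable m : {measure set T -> \bar R}.

Local Notation sigma_type := (g_sigma_algebraType (@measurable d T)).
Local Notation complete_type := (caratheodory_type m^*%mu).
Local Notation cm := (@completed_measure_extension _ _ _ m).

(* [LebR] is built from the outer measure of the extension, the completed
   measure from the outer measure of [m] itself: they have the same
   Caratheodory-measurable sets. *)
Lemma mu_ext_measure_extension :
  (measure_extension m)^*%mu = m^*%mu :> (set T -> \bar R).
Proof.
apply/funext => A; apply/eqP; rewrite eq_le; apply/andP; split.
- apply/ereal_infP => _ [F [mF AF] <-].
  apply: ereal_inf_lbound; exists F.
    by split=> // i; apply: sub_sigma_algebra; exact: mF.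
  by apply: eq_eseriesr => i _; exact: measurable_mu_extE.
- apply/ereal_infP => _ [F [_ AF] <-].
  apply: le_trans; first exact: (le_mu_ext m AF).
  exact: (outer_measure_sigma_subadditive m^*%mu).
Qed.

Lemma measurable_fun_caratheodory_mu_ext d' (rT : measurableType d')
    (D : set T) (f : T -> rT) :
  measurable_fun (D : set (caratheodory_type (measure_extension m)^*%mu)) f ->
  measurable_fun (D : set complete_type) f.
Proof.
have caraE A : caratheodory_measurable (measure_extension m)^*%mu A =
    caratheodory_measurable m^*%mu A by rewrite mu_ext_measure_extension.
move=> mf mD B mB; have := mf _ B mB.
change (((measure_extension m)^*%mu.-caratheodory D ->
  (measure_extension m)^*%mu.-caratheodory (D `&` f @^-1` B)) ->
  m^*%mu.-caratheodory (D `&` f @^-1` B)).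
by rewrite !caraE; exact.
Qed.

Lemma measurable_fun_complete d' (rT : measurableType d') (D : set T)
    (f : T -> rT) : measurable (D : set sigma_type) ->
  measurable_fun (D : set sigma_type) f ->
  measurable_fun (D : set complete_type) f.
Proof. by move=> mD mf _ B mB; apply: sub_caratheodory; exact: mf. Qed.

Lemma negligible_complete (A : set T) :
  (measure_extension m).-negligible A -> cm.-negligible A.
Proof.
by case=> B [mB B0 AB]; exists B; split => //; exact: sub_caratheodory.
Qed.

Lemma Rintegral_complete (D : set T) (f : T -> R) :
  measurable (D : set sigma_type) ->
  measurable_fun [set: sigma_type] f ->
  cm.-integrable (D : set complete_type) (EFin \o f) ->
  Rintegral cm D f = Rintegral (measure_extension m) D f.
Proof.
move=> mD mf intf; congr fine.
have measurable_idfun :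
    measurable_fun [set: complete_type] (idfun : complete_type -> sigma_type).
  by move=> _ B mB; rewrite setTI; exact: sub_caratheodory.
have := @integral_pushforward _ _ complete_type sigma_type R _
  measurable_idfun cm D (EFin \o f) _ intf mD.
move=> /= <-; last exact/measurable_EFinP.
pose nu : {measure set sigma_type -> \bar R} := pushforward cm
  (idfun : complete_type -> sigma_type).
exact: (@eq_measure_integral _ sigma_type R D (measure_extension m)
  (nu measurable_idfun)).
Qed.

End caratheodory_extension.

Lemma normr_indic_le1 (T : Type) (R : numDomainType) (A : set T) (t : T) :
  `|\1_A t : R| <= 1.
Proof. by rewrite indicE; case: (t \in A); rewrite ?normr1 ?normr0. Qed.

Section finite_measure_integrability.
Context d (T : measurableType d) {R : realType}.
Variables (mu : {measure set T -> \bar R}) (D : set T).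
Hypotheses (mD : measurable D) (muD : (mu D < +oo)%E).

Lemma integrable_bounded_by (f : T -> R) (M : R) : measurable_fun D f ->
  (forall t, D t -> `|f t| <= M) -> mu.-integrable D (EFin \o f).
Proof.
move=> mf fM; apply: measurable_bounded_integrable => //.
by exists M; split; [exact: num_real|move=> c /ltW Mc t /fM/le_trans; exact].
Qed.

Lemma normr_Rintegral_le_cst (f : T -> R) (M : R) : measurable_fun D f ->
  (forall t, D t -> `|f t| <= M) ->
  `|\int[mu]_(t in D) f t| <= M * fine (mu D).
Proof.
move=> mf fM; have intf := integrable_bounded_by mf fM.
apply: (le_trans (le_normr_Rintegral mD intf)).
rewrite -Rintegral_cst//; apply: le_Rintegral => //.
  exact: integrable_norm.
exact: (@integrable_bounded_by _ `|M|).
Qed.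

Lemma integrable_indic_on (A : set T) : measurable A ->
  mu.-integrable D (EFin \o \1_A : T -> \bar R).
Proof.
move=> mA; apply: (@integrable_bounded_by _ 1) => // t _.
exact: normr_indic_le1.
Qed.

Lemma integrable_of_sqr (f : T -> R) : measurable_fun D f ->
  mu.-integrable D (fun t => (f t ^+ 2)%:E) -> mu.-integrable D (EFin \o f).
Proof.
move=> mf intf2; have int1 : mu.-integrable D (EFin \o cst 1).
  exact: (@integrable_bounded_by _ `|1|).
apply: le_integrable (integrableD mD int1 intf2) => //.
  exact/measurable_EFinP.
move=> t _ /=; rewrite lee_fin ler_normr; apply/orP; left.
rewrite ler_norml.
by have := sqr_ge0 (f t + 2^-1); have := sqr_ge0 (f t - 2^-1); lra.
Qed.

End finite_measure_integrability.

Section weak_convergence.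
Import HBSimple.
Context d (T : measurableType d) {R : realType}.
Variables (mu : {measure set T -> \bar R}) (D : set T).
Hypotheses (mD : measurable D) (muD : (mu D < +oo)%E).
Context {I : Type} {F : set_system I} {FF : Filter F}.
Variables (k : I -> T -> R) (M : R).
Hypothesis mk : forall i, measurable_fun D (k i).
Hypothesis kM : forall i t, D t -> `|k i t| <= M.
Implicit Types (f g : T -> R) (A : set T).

Definition weakly_vanishing f :=
  \int[mu]_(t in D) (k i t * f t) @[i --> F] --> (0 : R).

Lemma integrable_kernelM f i : mu.-integrable D (EFin \o f) ->
  mu.-integrable D (EFin \o (fun t => k i t * f t)).
Proof.
move=> intf; have kb : [bounded k i t | t in D].
  exists M; split; first exact: num_real.
  by move=> c /ltW Mc t /(kM i)/le_trans; exact.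
exact: (integrableMr mD (mk i) kb intf).
Qed.

Lemma normr_Rintegral_kernelM_le f i : mu.-integrable D (EFin \o f) ->
  `|\int[mu]_(t in D) (k i t * f t)| <= M * \int[mu]_(t in D) `|f t|.
Proof.
move=> intf; have intkf := integrable_kernelM i intf.
apply: (le_trans (le_normr_Rintegral mD intkf)).
have int_f := integrable_norm intf.
rewrite -RintegralZl//; apply: le_Rintegral => //.
- exact: integrable_norm.
- exact: (integrableZl mD M int_f).
- by move=> t Dt; rewrite normrM ler_wpM2r// kM.
Qed.

Lemma weakly_vanishingD f g :
  mu.-integrable D (EFin \o f) -> mu.-integrable D (EFin \o g) ->
  weakly_vanishing f -> weakly_vanishing g -> weakly_vanishing (f \+ g).
Proof.
move=> intf intg vf vg; rewrite /weakly_vanishing -[X in _ --> X]addr0.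
under eq_fun => i.
  under eq_Rintegral do rewrite mulrDr.
  rewrite RintegralD//; [|exact: integrable_kernelM..]; over.
exact: cvgD vf vg.
Qed.

Lemma weakly_vanishingZ f (a : R) : mu.-integrable D (EFin \o f) ->
  weakly_vanishing f -> weakly_vanishing (fun t => a * f t).
Proof.
move=> intf vf; rewrite /weakly_vanishing -[X in _ --> X](mulr0 a).
under eq_fun => i.
  under eq_Rintegral do rewrite mulrCA.
  rewrite RintegralZl//; [|exact: integrable_kernelM]; over.
by apply: cvgM vf; exact: cvg_cst.
Qed.

Lemma weakly_vanishing_cvg_L1 f (g : (T -> R)^nat) :
  mu.-integrable D (EFin \o f) ->
  (forall n, mu.-integrable D (EFin \o g n)) ->
  (forall n, weakly_vanishing (g n)) ->
  (\int[mu]_(t in D) `|(f t - g n t)%:E|)%E @[n --> \oo] --> 0%E ->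
  weakly_vanishing f.
Proof.
move=> intf intg vg fg; apply/cvgrPdist_le => e e0.
have e20 : 0 < e / 2 by rewrite divr_gt0.
have [n fgn] : exists n, M * \int[mu]_(t in D) `|f t - g n t| <= e / 2.
  have /cvgrPdist_le/(_ _ e20)[n _ small] :
      M * \int[mu]_(t in D) `|f t - g j t| @[j --> \oo] --> (0 : R).
    rewrite -[X in _ --> X](mulr0 M); apply: cvgM; first exact: cvg_cst.
    exact: fine_cvg fg.
  exists n; have := small n (leqnn n).
  by rewrite sub0r normrN; apply: le_trans; exact: ler_norm.
have intfg : mu.-integrable D (EFin \o (fun t => f t - g n t)).
  exact: (integrableB mD intf (intg n)).
move/cvgrPdist_le/(_ _ e20) : (vg n); apply: filterS => i.
rewrite !sub0r !normrN => kg.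
have -> : \int[mu]_(t in D) (k i t * f t) =
    \int[mu]_(t in D) (k i t * (f t - g n t)) +
    \int[mu]_(t in D) (k i t * g n t).
  rewrite -RintegralD//; [|exact: integrable_kernelM..].
  by apply: eq_Rintegral => t _; rewrite -mulrDr subrK.
rewrite [leRHS]splitr (le_trans (ler_normD _ _))// lerD//.
exact: le_trans (normr_Rintegral_kernelM_le _ intfg) fgn.
Qed.

Definition weakly_vanishing_sets : set (set T) :=
  [set A | measurable A /\ weakly_vanishing \1_A].

Lemma weakly_vanishing_ndseq : ndseq_closed weakly_vanishing_sets.
Proof.
move=> A ndA vA; have mA n : measurable (A n) by have [] := vA n.
have mUA : measurable (\bigcup_n A n) by exact: bigcupT_measurable.
split=> //; apply: (@weakly_vanishing_cvg_L1 _ (fun n => \1_(A n))).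
- exact: (integrable_indic_on mD muD).
- by move=> n; exact: (integrable_indic_on mD muD).
- by move=> n; have [] := vA n.
have [|||||_ + _] := @dominated_convergence _ _ _ mu D mD
  (fun n => EFin \o \1_(A n)) (EFin \o \1_(\bigcup_n A n)) (cst 1%E).
- by move=> n; apply/measurable_EFinP.
- exact/measurable_EFinP.
- apply: aeW => t _; apply: cvg_EFin; first exact: nearW.
  apply: cvg_near_cst; have [[n _ Ant]|nAt] := pselect ((\bigcup_n A n) t).
  + exists n => // j /= nj; rewrite /= !indicE !mem_set//; first by exists n.
    by move: t Ant; apply/subsetPset/ndA.
  + apply: nearW => n; rewrite /= !indicE memNset.
      by rewrite memNset.
    by move=> Ant; apply: nAt; exists n.
- exact: (@integrable_bounded_by _ _ _ mu D mD muD (cst 1) `|1|).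
- by apply: aeW => t n _; rewrite lee_fin; exact: normr_indic_le1.
apply: cvg_trans; apply: near_eq_cvg; apply: nearW => n.
by apply: eq_integral => t _; rewrite -abseN fin_num_oppeB// addeC.
Qed.

Variable G : set (set T).
Hypotheses (GE : @measurable _ T = <<s G >>) (GI : setI_closed G).
Hypothesis cst1_vanishing : weakly_vanishing (cst 1).
Hypothesis G_vanishing : forall A, G A -> weakly_vanishing \1_A.

Lemma weakly_vanishing_indic A : measurable A -> weakly_vanishing \1_A.
Proof.
suff subG : <<s G >> `<=` weakly_vanishing_sets by rewrite GE => /subG[].
apply: (@lambda_system_subset _ _ GI setT) => // [|B GB]; last first.
  by split; [rewrite GE; exact: sub_sigma_algebra|exact: G_vanishing].
split => //; first by split => //; rewrite indicT.
  move=> B C CB [mB vB] [mC vC]; split; first exact: measurableD.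
  have -> : \1_(B `\` C) = \1_B \+ (fun t => -1 * \1_C t) :> (T -> R).
    apply/funext => t; rewrite /= !indicE in_setD; have := CB t.
    rewrite -(in_setE B) -(in_setE C).
    by case: (t \in B) (t \in C) => [] [] => [||/(_ isT)|] //= _; ring.
  apply: weakly_vanishingD => //.
  - exact: (integrable_indic_on mD muD).
  - exact: (integrableZl mD (-1) (integrable_indic_on mD muD mC)).
  - by apply: weakly_vanishingZ => //; exact: (integrable_indic_on mD muD).
exact: weakly_vanishing_ndseq.
Qed.

Lemma weakly_vanishing_sum_indic (a : R^nat) (A : (set T)^nat) n :
  (forall i, measurable (A i)) ->
  weakly_vanishing (fun t => \sum_(i < n) a i * \1_(A i) t).
Proof.
move=> mA; have int_indic i : mu.-integrable D (EFin \o \1_(A i) : T -> \bar R).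
  exact: (integrable_indic_on mD muD).
have int_term i : mu.-integrable D (EFin \o (fun t => a i * \1_(A i) t)).
  exact: (integrableZl mD (a i) (int_indic i)).
have indic_vanishing i := weakly_vanishing_indic (mA i).
elim: n => [|n IHn].
  have -> : (fun t => \sum_(i < 0) a i * \1_(A i) t) =
      (fun t => 0 * \1_(A 0) t).
    by apply/funext => t; rewrite big_ord0 mul0r.
  exact: weakly_vanishingZ.
under eq_fun do rewrite big_ord_recr /=.
apply: weakly_vanishingD => //; last exact: weakly_vanishingZ.
rewrite (_ : _ \o _ = fun t => (\sum_(i < n) (a i * \1_(A i) t)%:E)%E).
  by apply: integrable_sum => // i _; exact: int_term.
by apply/funext => t; rewrite /= sumEFin.
Qed.

Lemma weakly_vanishing_sfun (g : {sfun T >-> R}) : weakly_vanishing g.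
Proof.
pose r : seq R := finmap.enum_fset (fset_set (range g)).
rewrite (_ : (g : T -> R) =
    fun t => \sum_(i < size r) r`_i * \1_(g @^-1` [set r`_i]) t).
  apply: (@weakly_vanishing_sum_indic (nth 0 r) (fun i => g @^-1` [set r`_i])).
  by move=> i; exact: measurable_funPTI.
by apply/funext => t; rewrite fimfunEord.
Qed.

Lemma weakly_vanishing_integrable f :
  mu.-integrable D (EFin \o f) -> weakly_vanishing f.
Proof.
move=> intf.
have [g [intg _ fg]] := approximation_sfun_integrable mD intf.
apply: (@weakly_vanishing_cvg_L1 _ g) => // n.
exact: weakly_vanishing_sfun.
Qed.

End weak_convergence.

Lemma measurable_invr {R : realType} : measurable_fun [set: R] (@GRing.inv R).
Proof.
have mN0 : measurable (~` [set (0 : R)]) by apply: measurableC.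
rewrite -(setUv [set (0 : R)]); apply/measurable_funU => //; split.
  exact: measurable_fun_set1.
apply: open_continuous_measurable_fun.
  by rewrite openC; exact: closed_eq.
by move=> x; rewrite inE => /eqP x0; exact: inv_continuous.
Qed.

Section kernel.
Context {R : realType}.
Implicit Types x y s t : R.

Lemma Kker_le0 x y : x <= 0 -> Kker x y = 0.
Proof. by move=> x0; rewrite /Kker ltNge x0. Qed.

Lemma Kker_scale x y : 0 < x -> Kker x y = Kker 1 (x * y).
Proof. by move=> x0; rewrite /Kker x0 ltr01 mul1r pmulr_rgt0. Qed.

Lemma Kker_floor x y (n : int) : 0 < x -> 0 < y ->
  n%:~R <= (x * y)^-1 < (n + 1)%:~R ->
  Kker x y = 2^-1 - ((x * y)^-1 - n%:~R).
Proof. by move=> x0 y0 /floor_def nE; rewrite /Kker x0 y0 /fracpart nE. Qed.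

Lemma normr_Kker_le x y : `|Kker x y| <= 2^-1.
Proof.
rewrite /Kker; case: ifPn => [_|_]; last by rewrite normr0 invr_ge0.
have := ge_floor (x * y)^-1; have := floorD1_gt (x * y)^-1.
rewrite /fracpart intrD ler_norml; lra.
Qed.

Lemma measurable_Kker x (D : set R) : measurable_fun D (Kker x).
Proof.
have [x0|x0] := leP x 0.
  by rewrite (_ : Kker x = cst 0)//; apply/funext => y; exact: Kker_le0.
apply: measurable_funTS; rewrite /Kker x0 /=.
apply: measurable_fun_ifT => //; first exact: measurable_fun_ltr.
apply: measurable_funB => //; rewrite /fracpart.
have measurable_invM : measurable_fun setT (fun y => (x * y)^-1).
  by apply: measurableT_comp measurable_invr _; exact: measurable_funM.
apply: measurable_funB => //.
have measurable_floor :
    measurable_fun [set: R] (fun s => (Num.floor s)%:~R : R).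
  by apply: nondecreasing_measurable => // s t st; rewrite ler_int le_floor.
exact: measurableT_comp measurable_floor measurable_invM.
Qed.

Lemma continuous_Kker1 s : (forall n : int, s != n%:~R^-1) ->
  {for s, continuous (Kker 1)}.
Proof.
move=> sn; have [s0|s0|s0] := ltgtP s 0.
- apply: cvg_near_cst; apply: filterS (lt_nbhsl s0) => t t0.
  by rewrite /Kker (lt_gtF t0) (lt_gtF s0) andbF.
- pose n := Num.floor s^-1.
  have ns : n%:~R < s^-1.
    rewrite lt_neqAle ge_floor andbT; apply: contra (sn n) => /eqP ->.
    by rewrite invrK.
  have sn1 : s^-1 < (n + 1)%:~R by exact: floorD1_gt.
  have cvgV_s : t^-1 @[t --> s] --> s^-1 by apply: cvgV => //; rewrite gt_eqF.
  rewrite /prop_for /continuous_at (@Kker_floor 1 s n)// mul1r ?(ltW ns)//.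
  have : 2^-1 - (t^-1 - n%:~R) @[t --> s] --> 2^-1 - (s^-1 - n%:~R).
    by apply: cvgB; [exact: cvg_cst|apply: cvgB => //; exact: cvg_cst].
  apply: cvg_trans; apply: near_eq_cvg; near=> t.
  rewrite (@Kker_floor 1 t n)// ?mul1r//; first by near: t; exact: lt_nbhsr.
  apply/andP; split.
    by apply/ltW; near: t; exact: cvgr_gt cvgV_s _ ns.
  by near: t; exact: cvgr_lt cvgV_s _ sn1.
- by have := sn 0; rewrite s0 invr0 eqxx.
Unshelve. all: by end_near. Qed.

Lemma continuous_Kkerl x y : 0 < x -> (forall n : int, x * y != n%:~R^-1) ->
  {for x, continuous (Kker ^~ y)}.
Proof.
move=> x0 xyn; have : {for x, continuous (Kker 1 \o *%R^~ y)}.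
  apply: continuous_comp; last exact: continuous_Kker1.
  by apply: cvgM; [exact: cvg_id|exact: cvg_cst].
rewrite /prop_for /continuous_at (Kker_scale _ x0).
apply: cvg_trans; apply: near_eq_cvg; near=> z.
by rewrite [RHS]Kker_scale//; near: z; exact: lt_nbhsr.
Unshelve. all: by end_near. Qed.

End kernel.

Section lebesgue_interval.
Context {R : realType}.
Local Notation mu := (@lebesgue_measure R).

Lemma lebesgue_measure_itv_lty (a b : R) (c d : bool) :
  (mu [set` Interval (BSide c a) (BSide d b)] < +oo)%E.
Proof.
by rewrite lebesgue_measure_itv/=; case: ifP => _; rewrite -?EFinB ltry.
Qed.

Lemma fine_lebesgue_measure_itv (a b : R) (c d : bool) : a <= b ->
  fine (mu [set` Interval (BSide c a) (BSide d b)]) = b - a.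
Proof.
move=> ab; rewrite lebesgue_measure_itv/= lte_fin; case: ltP => //= ba.
by apply/eqP; rewrite eq_sym subr_eq0 eq_le ab ba.
Qed.

Lemma Rintegral_centered (a b : R) : a < b ->
  \int[mu]_(y in `]a, b]) (y - (a + b) / 2) = 0.
Proof.
move=> ab; pose F (y : R) := 2^-1 * (y - (a + b) / 2) ^+ 2.
have dF (y : R) : is_derive y 1 F (y - (a + b) / 2).
  by apply: is_derive_eq; rewrite /GRing.scale/=; field.
have cF : continuous F.
  move=> y; apply: differentiable_continuous; apply/derivable1_diffP.
  exact: ex_derive.
have cf : continuous (fun y : R => y - (a + b) / 2).
  by move=> y; apply: cvgB; [exact: cvg_id|exact: cvg_cst].
rewrite Rintegral_itv_obnd_cbnd; last first.
  apply: (@integrableS _ _ _ mu `[a, b]) => //; first exact: subset_itv_oc_cc.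
  apply: continuous_compact_integrable; first exact: segment_compact.
  exact: continuous_subspaceT.
rewrite /Rintegral (@continuous_FTC2 _ _ F)//=.
- by rewrite /F; lra.
- exact: continuous_subspaceT.
- split; first by move=> y _; exact: ex_derive.
    exact/cvg_at_right_filter/cF.
  exact/cvg_at_left_filter/cF.
- by move=> y _; rewrite derive1E derive_val.
Qed.

End lebesgue_interval.

Section kernel_primitive.
Context {R : realType}.
Local Notation mu := (@lebesgue_measure R).
Implicit Types (x y s t : R) (n m : nat).

Definition Kjump x n : R := (x * n%:R)^-1.

Lemma Kjump_gt0 x n : 0 < x -> (0 < n)%N -> 0 < Kjump x n.
Proof. by move=> x0 n0; rewrite invr_gt0 mulr_gt0// ltr0n. Qed.

Lemma Kjump_le x n m : 0 < x -> (0 < n)%N -> (n <= m)%N ->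
  Kjump x m <= Kjump x n.
Proof.
move=> x0 n0 nm; rewrite lef_pV2 ?posrE ?mulr_gt0 ?ltr0n ?(leq_trans n0)//.
by rewrite ler_pM2l// ler_nat.
Qed.

Lemma Kjump_lt x n : 0 < x -> (0 < n)%N -> Kjump x n.+1 < Kjump x n.
Proof.
move=> x0 n0; rewrite ltf_pV2 ?posrE ?mulr_gt0 ?ltr0n//.
by rewrite ltr_pM2l// ltr_nat.
Qed.

(* Runs from [-1/2] to [1/2] between two consecutive jumps of [Kker x]. *)
Definition Kaffine x n y : R :=
  x * n%:R * n.+1%:R * (y - (Kjump x n.+1 + Kjump x n) / 2).

Lemma Kker_near_affine x y n : 0 < x -> (0 < n)%N ->
  Kjump x n.+1 < y -> y <= Kjump x n ->
  `|Kker x y - Kaffine x n y| <= n%:R^-1.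
Proof.
move=> x0 n0 ylo yhi; have y0 := lt_trans (Kjump_gt0 x0 (ltn0Sn n)) ylo.
have N0 : 0 < n%:R :> R by rewrite ltr0n.
have z0 : 0 < x * y by exact: mulr_gt0.
have lo : 1 < (n%:R + 1) * (x * y).
  move: ylo; rewrite /Kjump -[_^-1]mul1r ltr_pdivrMr ?mulr_gt0//.
  by rewrite -natr1; lra.
have hi : n%:R * (x * y) <= 1.
  by move: yhi; rewrite /Kjump -[_^-1]mul1r ler_pdivlMr ?mulr_gt0//; lra.
have nzV : n%:R <= (x * y)^-1 < n%:R + 1.
  by rewrite -[_^-1]mul1r ler_pdivlMr// ltr_pdivrMr// hi lo.
rewrite (@Kker_floor _ _ _ n)//; last by rewrite intrD -!pmulrn.
have -> : 2^-1 - ((x * y)^-1 - n%:R) - Kaffine x n y =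
    ((x * y)^-1 - n%:R) * ((n%:R + 1) * (x * y) - 1).
  by rewrite /Kaffine /Kjump -natr1; field; rewrite nat1r !gt_eqF ?ltr0n.
have xy_le : x * y <= n%:R^-1 by rewrite -[leRHS]mul1r ler_pdivlMr// mulrC.
case/andP: nzV => nz zn.
rewrite ger0_norm; last by rewrite mulr_ge0 ?subr_ge0// ltW.
by apply: le_trans xy_le; apply: le_trans (ler_piMl _ _) _; lra.
Qed.

Lemma integrable_Kker_itv x (a b : R) (c d : bool) :
  mu.-integrable [set` Interval (BSide c a) (BSide d b)] (EFin \o Kker x).
Proof.
apply: (@integrable_bounded_by _ _ _ mu _ _ _ _ 2^-1) => //.
- exact: lebesgue_measure_itv_lty.
- exact: measurable_Kker.
- by move=> y _; exact: normr_Kker_le.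
Qed.

Lemma normr_Rintegral_Kker_jump_le x n : 0 < x -> (0 < n)%N ->
  `|\int[mu]_(y in `]Kjump x n.+1, Kjump x n]) Kker x y| <=
  n%:R^-1 * (Kjump x n - Kjump x n.+1).
Proof.
move=> x0 n0; have lt_jump := Kjump_lt x0 n0.
pose centered y := y - (Kjump x n.+1 + Kjump x n) / 2.
have measurable_centered (D : set R) : measurable_fun D centered.
  exact: measurable_funB.
have int_centered : mu.-integrable `]Kjump x n.+1, Kjump x n]
    (EFin \o centered).
  apply: (@integrable_bounded_by _ _ _ mu _ _ _ _
    (Kjump x n - Kjump x n.+1)) => //.
  - exact: lebesgue_measure_itv_lty.
  - exact: measurable_centered.
  - by move=> y /=; rewrite in_itv/= ler_norml /centered; lra.
have -> : \int[mu]_(y in `]Kjump x n.+1, Kjump x n]) Kker x y =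
    \int[mu]_(y in `]Kjump x n.+1, Kjump x n]) (Kker x y - Kaffine x n y).
  rewrite RintegralB//; last 2 first.
  - exact: integrable_Kker_itv.
  - exact: (@integrableZl _ _ _ mu _ _ (x * n%:R * n.+1%:R) _
      int_centered).
  by rewrite RintegralZl// Rintegral_centered// mulr0 subr0.
rewrite -(@fine_lebesgue_measure_itv _ _ _ false false (ltW lt_jump)).
apply: normr_Rintegral_le_cst => //.
- exact: lebesgue_measure_itv_lty.
- apply: measurable_funB; first exact: measurable_Kker.
  by apply: measurable_funM => //; exact: measurable_centered.
- move=> y /=; rewrite in_itv/= => /andP[]; exact: Kker_near_affine.
Qed.

Definition Kprimitive x t : R := \int[mu]_(y in `[0, t]) Kker x y.

Lemma Kprimitive0 x : Kprimitive x 0 = 0.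
Proof. by rewrite /Kprimitive set_itv1 Rintegral_set1. Qed.

Lemma KprimitiveB x s t : 0 <= s -> s <= t ->
  Kprimitive x t - Kprimitive x s = \int[mu]_(y in `]s, t]) Kker x y.
Proof.
move=> s0 st; apply: Rintegral_itvB; rewrite ?bnd_simp//.
exact: integrable_Kker_itv.
Qed.

Lemma normr_KprimitiveB_le x s t : 0 <= s -> s <= t ->
  `|Kprimitive x t - Kprimitive x s| <= 2^-1 * (t - s).
Proof.
move=> s0 st; rewrite KprimitiveB//.
rewrite -(@fine_lebesgue_measure_itv _ _ _ false false st).
apply: normr_Rintegral_le_cst => //.
- exact: lebesgue_measure_itv_lty.
- exact: measurable_Kker.
- by move=> y _; exact: normr_Kker_le.
Qed.

Lemma normr_Kprimitive_jumpB_le x n m : 0 < x -> (0 < n)%N ->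
  `|Kprimitive x (Kjump x n) - Kprimitive x (Kjump x (n + m)%N)| <=
  n%:R^-1 * (Kjump x n - Kjump x (n + m)%N).
Proof.
move=> x0 n0; elim: m => [|m IHm]; first by rewrite addn0 !subrr normr0 mulr0.
have nm0 : (0 < n + m)%N by rewrite addn_gt0 n0.
rewrite -(subrKA (Kprimitive x (Kjump x (n + m)%N))).
rewrite (le_trans (ler_normD _ _))//.
rewrite -(subrKA (Kjump x (n + m)%N) (Kjump x n)) [leRHS]mulrDr lerD//.
have le_jump := Kjump_le x0 nm0 (leqnSn (n + m)).
rewrite addnS KprimitiveB//; last exact/ltW/Kjump_gt0.
apply: (le_trans (normr_Rintegral_Kker_jump_le x0 nm0)).
rewrite ler_wpM2r ?subr_ge0// lef_pV2 ?posrE ?ltr0n//.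
by rewrite ler_nat leq_addr.
Qed.

Lemma normr_Kprimitive_jump_le x n : 0 < x -> (0 < n)%N ->
  `|Kprimitive x (Kjump x n)| <= x * Kjump x n ^+ 2.
Proof.
(* The jumps accumulate at [0], where the primitive vanishes. *)
move=> x0 n0; apply/ler_addgt0Pr => e e0.
pose m := (Num.trunc (x * e)^-1).+1.
have jump_le_e : Kjump x (n + m)%N <= e.
  apply: (le_trans (Kjump_le x0 (ltn0Sn _) (leq_addl n m))).
  rewrite invf_ple ?posrE ?mulr_gt0// -(ler_pM2l (_ : 0 < x^-1)) ?invr_gt0//.
  by rewrite mulKf ?gt_eqF// -invfM ltW// truncnS_gt.
have nm0 : (0 < n + m)%N by rewrite addn_gt0 n0.
have := normr_Kprimitive_jumpB_le m x0 n0.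
have := normr_KprimitiveB_le x (lexx 0) (ltW (Kjump_gt0 x0 nm0)).
rewrite Kprimitive0 !subr0.
have -> : x * Kjump x n ^+ 2 = n%:R^-1 * Kjump x n.
  by rewrite /Kjump; field; rewrite !gt_eqF ?ltr0n.
have := ler_normD (Kprimitive x (Kjump x n) -
  Kprimitive x (Kjump x (n + m)%N)) (Kprimitive x (Kjump x (n + m)%N)).
rewrite subrK mulrBr.
have : 0 <= n%:R^-1 * Kjump x (n + m)%N.
  by apply: mulr_ge0; [rewrite invr_ge0|exact/ltW/Kjump_gt0].
lra.
Qed.

Lemma normr_Kprimitive_le x t : 0 < x -> 0 <= t ->
  `|Kprimitive x t| <= 2 * x * t ^+ 2.
Proof.
move=> x0; rewrite le_eqVlt => /predU1P[<-|t0].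
  by rewrite Kprimitive0 normr0 expr0n mulr0.
have xt0 : 0 < x * t by exact: mulr_gt0.
pose n := Num.trunc (x * t)^-1; pose c := Kjump x n.+1.
have /andP[] : n%:R <= (x * t)^-1 < n.+1%:R.
  by apply: truncn_itv; rewrite invr_ge0 ltW.
rewrite -[_^-1]mul1r ler_pdivlMr// ltr_pdivrMr// => n_le lt_n.
have c0 : 0 < c by exact: Kjump_gt0.
have ct : c <= t.
  rewrite /c /Kjump -[leLHS]mul1r ler_pdivrMr ?mulr_gt0//.
  by rewrite mulrCA mulrA mulrC ltW.
have gap_le : t - c <= x * t * c.
  have -> : t - c = (n.+1%:R * (x * t) - 1) * c.
    by rewrite /c /Kjump; field; rewrite !gt_eqF ?ltr0n.
  by rewrite ler_pM2r// -natr1; lra.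
have := normr_Kprimitive_jump_le x0 (ltn0Sn n).
have := normr_KprimitiveB_le x (ltW c0) ct.
have := ler_normD (Kprimitive x t - Kprimitive x c) (Kprimitive x c).
rewrite subrK -/c.
have : x * t * c <= x * t ^+ 2 by rewrite expr2 mulrA ler_pM2l.
have : x * c ^+ 2 <= x * t ^+ 2.
  by rewrite ler_pM2l// ler_pXn2r// nnegrE ltW.
lra.
Qed.

End kernel_primitive.

Section riemann_lebesgue.
Context {R : realType}.
Local Notation mu := (@lebesgue_measure R).

Lemma cvg_Kprimitive0 (t : R) : 0 <= t -> Kprimitive x t @[x --> 0^'+] --> 0.
Proof.
move=> t0; apply/cvgr0Pnorm_le => e e0.
have denom_gt0 : 0 < 2 * t ^+ 2 + 1 by rewrite ltr_wpDl// mulr_ge0// exprn_ge0.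
near=> x.
have x0 : 0 < x by near: x; exact: nbhs_right_gt.
apply: (le_trans (normr_Kprimitive_le x0 t0)).
have : x < e / (2 * t ^+ 2 + 1).
  by near: x; apply: nbhs_right_lt; exact: divr_gt0.
by rewrite ltr_pdivlMr//; lra.
Unshelve. all: by end_near. Qed.

Lemma RGenInftyO_setI_closed : setI_closed (@RGenInftyO.G R).
Proof.
move=> _ _ [s ->] [t ->]; exists (Num.min s t).
by apply/seteqP; split=> y /=; rewrite !in_itv/= lt_min => /andP.
Qed.

Lemma Rintegral_Kker_ray (x t : R) :
  \int[mu]_(y in `[0, 1]) (Kker x y * \1_(`]-oo, t[) y) =
  Kprimitive x (Num.max 0 (Num.min t 1)).
Proof.
rewrite -[LHS]/(Rintegral mu _ (Kker x \* _)) -patch_indic -Rintegral_mkcondr.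
have [t1|t1] := ltP 1 t.
  rewrite max_r//; congr Rintegral.
  by apply/setIidPl => y /=; rewrite !in_itv/=; lra.
have [t0|t0] := leP 0 t.
  rewrite /Kprimitive -Rintegral_itv_bndo_bndc; last first.
    exact: integrable_Kker_itv.
  by congr Rintegral; apply/seteqP; split => y /=; rewrite !in_itv/=; lra.
rewrite Kprimitive0 (_ : _ `&` _ = set0) ?Rintegral_set0//.
by apply/seteqP; split => y //=; rewrite !in_itv/=; lra.
Qed.

Lemma cvg_Rintegral_Kker0 (f : R -> R) : mu.-integrable `[0, 1] (EFin \o f) ->
  \int[mu]_(y in `[0, 1]) (Kker x y * f y) @[x --> 0^'+] --> 0.
Proof.
apply: (@weakly_vanishing_integrable _ _ _ mu _ _ _ _ _ _ _ 2^-1 _ _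
  (@RGenInftyO.G R)) => //.
- exact: lebesgue_measure_itv_lty.
- by move=> x; exact: measurable_Kker.
- by move=> x y _; exact: normr_Kker_le.
- exact: RGenInftyO.measurableE.
- exact: RGenInftyO_setI_closed.
- rewrite /weakly_vanishing.
  under eq_fun do under eq_Rintegral do rewrite mulr1.
  exact: cvg_Kprimitive0.
- move=> _ [t ->]; rewrite /weakly_vanishing.
  under eq_fun do rewrite Rintegral_Kker_ray.
  by apply: cvg_Kprimitive0; rewrite le_max lexx.
Qed.

End riemann_lebesgue.

Section kernel_transform.
Context {R : realType}.

Local Notation leb_type := (caratheodory_type (R:=R) (@wlength R idfun)^*%mu).
Local Notation cmu := (@completed_lebesgue_measure R).
Local Notation mu := (@lebesgue_measure R).
Local Notation unit_itv := (`[0%R, 1%R]%classic : set leb_type).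

Lemma measurable_unit_itv : measurable unit_itv.
Proof. by apply: sub_caratheodory; exact: measurable_itv. Qed.

Lemma completed_unit_itv_lty : (cmu unit_itv < +oo)%E.
Proof. exact: (lebesgue_measure_itv_lty 0 1 true false). Qed.

Lemma countable_completed_negligible (A : set R) : countable A ->
  cmu.-negligible A.
Proof.
move=> cA; apply: negligible_complete; exists A; split => //.
  exact: (countable_measurable (@measurable_set1 R)).
exact: countable_lebesgue_measure0.
Qed.

Lemma measurable_Kker_complete (x : R) :
  measurable_fun unit_itv (Kker x : leb_type -> R).
Proof.
apply: measurable_fun_complete; first exact: measurable_itv.
exact: measurable_Kker.
Qed.

Definition Ktransform (phi : R -> R) (x : R) : R :=
  Rintegral cmu unit_itv (fun y => Kker x y * phi y).

Lemma Ktransform_le0 (phi : R -> R) (x : R) : x <= 0 -> Ktransform phi x = 0.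
Proof.
move=> x0; rewrite /Ktransform.
under eq_Rintegral do rewrite Kker_le0// mul0r.
by rewrite Rintegral_cst ?mul0r//; exact: measurable_unit_itv.
Qed.

Lemma integrable_KkerM (f : R -> R) (x : R) :
  cmu.-integrable unit_itv (EFin \o f) ->
  cmu.-integrable unit_itv (EFin \o (fun y => Kker x y * f y)).
Proof.
apply: (@integrable_kernelM _ _ _ cmu _ measurable_unit_itv R Kker 2^-1).
  by move=> z; exact: measurable_Kker_complete.
by move=> z y _; exact: normr_Kker_le.
Qed.

Lemma Ktransform_borel (f : R -> R) (x : R) : measurable_fun [set: R] f ->
  cmu.-integrable unit_itv (EFin \o f) ->
  Ktransform f x = \int[mu]_(y in `[0, 1]) (Kker x y * f y).
Proof.
move=> mf intf; apply: Rintegral_complete; first exact: measurable_itv.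
  by apply: measurable_funM => //; exact: measurable_Kker.
exact: integrable_KkerM.
Qed.

Variable phi : R -> R.
Hypothesis iphi : cmu.-integrable unit_itv (EFin \o phi).

Lemma normr_Ktransform_le (x : R) :
  `|Ktransform phi x| <= 2^-1 * Rintegral cmu unit_itv (fun y => `|phi y|).
Proof.
apply: (@normr_Rintegral_kernelM_le _ _ _ cmu _ measurable_unit_itv R Kker
  2^-1) => //.
  by move=> z; exact: measurable_Kker_complete.
by move=> z y _; exact: normr_Kker_le.
Qed.

Lemma continuous_Ktransform_gt0 (x : R) : 0 < x ->
  {for x, continuous (Ktransform phi)}.
Proof.
move=> x0; apply/(@cvg_nbhsP _ R^o) => u ux.
have mK z : measurable_fun unit_itv (fun y => (Kker z y * phi y)%:E).
  by case/integrableP : (integrable_KkerM z iphi).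
have cA : countable (range (fun n : int => x^-1 * n%:~R^-1)).
  by apply: card_le_trans (card_image_le _ _) _; exact: countableP.
have aeK : {ae cmu, forall y, unit_itv y ->
    (Kker (u n) y * phi y)%:E @[n --> \oo] --> (Kker x y * phi y)%:E}.
  apply: negligibleS (countable_completed_negligible cA) => y /= ncvg.
  apply: contrapT => yA; apply: ncvg => _; apply: cvg_EFin; first exact: nearW.
  apply: cvgM; last exact: cvg_cst.
  apply: (@cvg_comp _ _ _ u (Kker ^~ y) _ _ _ ux).
  apply: continuous_Kkerl => // n.
  apply/eqP => xyE; apply: yA.
  by exists n => //; rewrite -xyE mulKf// gt_eqF.
have aeB : {ae cmu, forall y n, unit_itv y ->
    (`|(Kker (u n) y * phi y)%:E| <= `|phi y|%:E)%E}.
  apply: aeW => y n _; rewrite lee_fin normrM ler_piMl//.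
  by rewrite (le_trans (normr_Kker_le _ _))//; lra.
have [_ _] := dominated_convergence measurable_unit_itv
  (fun n => mK (u n)) (mK x) aeK (integrable_norm iphi) aeB.
have -> : (\int[cmu]_(y in unit_itv) (Kker x y * phi y)%:E)%E =
    (Ktransform phi x)%:E.
  rewrite fineK//; apply: integrable_fin_num; first exact: measurable_unit_itv.
  exact: integrable_KkerM.
exact: fine_cvg.
Qed.

Lemma measurable_Ktransform : measurable_fun [set: R] (Ktransform phi).
Proof.
rewrite -set_itvNyy (@itv_bndbnd_setU _ _ _ (BRight 0))//.
apply/measurable_funU => //; split.
  apply: (@eq_measurable_fun _ _ R R _ (cst 0)) => // x.
  by rewrite inE/= in_itv/= => x0; rewrite Ktransform_le0.
apply: open_continuous_measurable_fun; first exact: interval_open.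
by move=> x; rewrite inE/= in_itv/= andbT; exact: continuous_Ktransform_gt0.
Qed.

(* An eigenfunction is only Lebesgue measurable, but its transform is Borel and
   bounded and satisfies the same equation, now for the Borel measure. *)
Lemma cvg_Ktransform0 (lam : R) :
  (forall x, x \in `[0, 1] -> phi x = lam * Ktransform phi x) ->
  Ktransform phi x @[x --> 0^'+] --> 0.
Proof.
move=> phiE; set T := Ktransform phi.
have mT : measurable_fun [set: R] T := measurable_Ktransform.
have intT : mu.-integrable `[0, 1] (EFin \o T).
  have mu01 := lebesgue_measure_itv_lty (0 : R) 1 true false.
  apply: (integrable_bounded_by _ mu01) => //.
    exact: measurable_funTS.
  by move=> x _; exact: normr_Ktransform_le.
have cintT : cmu.-integrable unit_itv (EFin \o T).
  apply: (integrable_bounded_by measurable_unit_itv completed_unit_itv_lty).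
    apply: measurable_fun_complete; first exact: measurable_itv.
    exact: measurable_funTS.
  by move=> x _; exact: normr_Ktransform_le.
have TE x : T x = lam * \int[mu]_(y in `[0, 1]) (Kker x y * T y).
  rewrite -Ktransform_borel// -RintegralZl; last 2 first.
  - exact: measurable_unit_itv.
  - exact: integrable_KkerM.
  by apply: eq_Rintegral => y; rewrite inE => /phiE ->; rewrite mulrCA.
rewrite (funext TE) -[X in _ --> X](mulr0 lam).
by apply: cvgM; [exact: cvg_cst|exact: cvg_Rintegral_Kker0].
Qed.

Lemma continuous_Ktransform (lam : R) :
  (forall x, x \in `[0, 1] -> phi x = lam * Ktransform phi x) ->
  continuous (Ktransform phi).
Proof.
move=> phiE x; have [x0|x0|->] := ltgtP x 0.
- apply: cvg_near_cst; apply: filterS (lt_nbhsl x0) => y y0.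
  by rewrite !Ktransform_le0 ?ltW.
- exact: continuous_Ktransform_gt0.
- apply/left_right_continuousP; rewrite Ktransform_le0//; split.
    apply: cvg_near_cst; apply: filterS (nbhs_left_lt 0) => y y0.
    by rewrite Ktransform_le0 ?ltW.
  exact: cvg_Ktransform0 phiE.
Qed.

End kernel_transform.

Theorem theorem2p10 (R : realType) (phi : R -> R) (lam : R) :
  is_eigenfunction phi lam -> {within `[0%R, 1%R], continuous phi}.
Proof.
case=> mphi iphi2 _ phiE.
have iphi := integrable_of_sqr measurable_unit_itv completed_unit_itv_lty
  (measurable_fun_caratheodory_mu_ext mphi) iphi2.
have cT := continuous_Ktransform iphi phiE.
have : {within `[0%R, 1%R], continuous (fun x => lam * Ktransform phi x)}.
  by apply: continuous_subspaceT => x; apply: cvgM; [exact: cvg_cst|exact: cT].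
by apply: subspace_eq_continuous => x; rewrite inE => x01; exact/esym/phiE.
Qed.
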